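(* Let $(L,\cdot)$ be a quasigroup (respectively, loop) with holomorph $H(L)$. If $H(L)$ is a CIPQ (respectively, CIPL), then $L$ is a flexible unipotent CIPQ (respectively, a flexible CIPL of exponent $2$).
   Context: Mappings are written on the right of their arguments, so $x\alpha$ is the image of $x$ under $\alpha$, and $\alpha\beta$ means first $\alpha$, then $\beta$. A quasigroup $(L,\cdot)$ is a non-empty set with a binary operation such that for all $a,b\in L$ the equations $a\cdot x=b$ and $y\cdot a=b$ have unique solutions $x,y\in L$. A loop is a quasigroup with a (unique) two-sided identity element $e$. For $x\in L$, the right inverse $x^\rho=xJ_\rho$ and the left inverse $x^\lambda=xJ_\lambda$ are the elements with $x\cdot x^\rho=e^\rho$ and $x^\lambda\cdot x=e^\lambda$, where $e^\rho$ and $e^\lambda$ are the right and left identity elements; whenever inverses are used in a quasigroup these elements are assumed to exist (in a loop both equal $e$). $AUM(L)$ is the automorphism group: the group of bijections $A$ of $L$ with $xA\cdot yA=(x\cdot y)A$ for all $x,y\in L$. The holomorph $H(L)$ is the set of pairs $(\alpha,x)$ with $\alpha\in AUM(L)$, $x\in L$, with operation $(\alpha,x)\circ(\beta,y)=(\alpha\beta,\ x\beta\cdot y)$. A quasigroup (loop) is a CIPQ (CIPL), i.e. a cross inverse property quasigroup (loop), if it satisfies one of the equivalent identities $(xy)x^\rho=y$, $x(yx^\rho)=y$, $x^\lambda(yx)=y$, $(x^\lambda y)x=y$. Flexible means $(xy)x=x(yx)$ for all $x,y$; unipotent means $x\cdot x=y\cdot y$ for all $x,y$; a loop has exponent $2$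 if $x\cdot x=e$ for all $x$. *)

(* Defs.v *)
From mathcomp Require Import all_boot.
From Stdlib Require Import FunctionalExtensionality ProofIrrelevance.

Set Implicit Arguments.
Unset Strict Implicit.
Unset Printing Implicit Defensive.

Section Quasigroups.

Variables (L : Type) (op : L -> L -> L).

Definition is_quasigroup : Prop :=
  [/\ inhabited L,
      forall a b, exists! x, op a x = b
    & forall a b, exists! y, op y a = b].

Definition is_loop : Prop :=
  is_quasigroup /\ exists e, left_id e op /\ right_id e op.

Definition flexible : Prop := forall x y, op (op x y) x = op x (op y x).

Definition unipotent : Prop := forall x y, op x x = op y y.

Definition exponent2 : Prop :=
  exists e, [/\ left_id e op, right_id e op & forall x, op x x = e].

(* In a quasigroup with right (resp. left) identity e, the inverse x^rho
   (resp. x^lambda) is the unique xr with op x xr = e (resp. the unique xl with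
   op xl x = e); the identity elements and inverses used are part of the
   cross inverse property. *)
Definition cip_rho_outer : Prop :=
  exists2 e, right_id e op &
    forall x xr y, op x xr = e -> op (op x y) xr = y.

Definition cip_rho_inner : Prop :=
  exists2 e, right_id e op &
    forall x xr y, op x xr = e -> op x (op y xr) = y.

Definition cip_lambda_outer : Prop :=
  exists2 e, left_id e op &
    forall x xl y, op xl x = e -> op xl (op y x) = y.

Definition cip_lambda_inner : Prop :=
  exists2 e, left_id e op &
    forall x xl y, op xl x = e -> op (op xl y) x = y.

Definition cross_inverse : Prop :=
  [\/ cip_rho_outer, cip_rho_inner, cip_lambda_outer | cip_lambda_inner].

Definition is_CIPQ : Prop := is_quasigroup /\ cross_inverse.

Definition is_CIPL : Prop := is_loop /\ cross_inverse.

Lemma quasigroup_cancel :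
  is_quasigroup -> left_injective op /\ right_injective op.
Proof.
case=> _ hr hl; split=> a b c.
  by move=> E; case: (hl a (op c a)) => z [_ u]; rewrite -(u b E) -(u c erefl).
by move=> E; case: (hr a (op a c)) => z [_ u]; rewrite -(u b E) -(u c erefl).
Qed.

Lemma cross_inverse_equiv : is_quasigroup ->
  [<-> cip_rho_outer; cip_rho_inner; cip_lambda_outer; cip_lambda_inner].
Proof.
move=> /quasigroup_cancel [injl injr]; tfae.
- case=> e he h; exists e => // x xr y E.
  by apply: (injl xr); apply: h.
- case=> e he h; exists e => [y|x xl y E]; last exact: h.
  by rewrite -{1}(he y); apply: h; apply: he.
- case=> e he h; exists e => // x xl y E.
  by apply: (injr xl); apply: h.
- case=> e he h; exists e => [y|x xr y E]; last exact: h.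
  by rewrite -{1}(he y); apply: h; apply: he.
Qed.

(* Maps are written on the right in the source: x alpha is (sval alpha x), and
   alpha beta (first alpha, then beta) is aum_mul alpha beta. *)
Definition is_automorphism (A : L -> L) : Prop :=
  bijective A /\ {morph A : x y / op x y}.

Definition AUM : Type := {A : L -> L | is_automorphism A}.

Lemma AUM_ext (a b : AUM) : sval a =1 sval b -> a = b.
Proof.
case: a b => [f pf] [g pg] /= E.
have {}E : f = g by apply: functional_extensionality.
by rewrite -{}E in pg *; rewrite (proof_irrelevance _ pf pg).
Qed.

Lemma comp_automorphism (A B : L -> L) :
  is_automorphism A -> is_automorphism B -> is_automorphism (B \o A).
Proof.
case=> bA mA [bB mB]; split; first exact: bij_comp.
by move=> x y /=; rewrite mA mB.
Qed.

Definition aum_mul (a b : AUM) : AUM :=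
  exist _ (sval b \o sval a) (comp_automorphism (svalP a) (svalP b)).

Definition holomorph : Type := (AUM * L)%type.

Definition hol_op (p q : holomorph) : holomorph :=
  (aum_mul p.1 q.1, op (sval q.1 p.2) q.2).

End Quasigroups.

(* Main.v *)
Require Import Defs.
From mathcomp Require Import all_boot.
From Stdlib Require Import IndefiniteDescription.

Set Implicit Arguments.
Unset Strict Implicit.
Unset Printing Implicit Defensive.

(** The cross inverse property of the holomorph is so strong that it kills every
    automorphism of [L], after which everything else follows from the behaviour
    of the inverse map.

    Evaluating the identity [(xy)x^rho = y] of [H(L)] at the pairs whose first
    component is the identity shows that [L] itself has the cross inverse
    property.  Evaluating it at [(alpha, e)] and [(1, z)], with [(beta, y)] the
    inverse of [(alpha, e)], gives [(e beta . z beta) y = z]; but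
    [e beta . y = e], so the cross inverse property of [L] says that the left
    side is [z beta].  Hence [beta], and with it [alpha = beta^-1], is the
    identity ([holomorph_cip_trivial_aut]).

    In a cross inverse property quasigroup [x |-> x^rho] is an automorphism
    ([cip_inverse_automorphism]), so here [x^rho = x].  Then [x . x = e] for all
    [x], which is unipotence, and the cross inverse identities become
    [(xy)x = y = x(yx)], which is flexibility. *)

Section CrossInverse.

Variables (L : Type) (op : L -> L -> L).
Hypothesis quasi : is_quasigroup op.

Lemma cross_inverse_rho_outer : cross_inverse op -> cip_rho_outer op.
Proof.
have E := cross_inverse_equiv quasi.
case=> // H; [exact: (E 1 0).1 | exact: (E 2 0).1 | exact: (E 3 0).1].
Qed.

Section Identity.

Variable e : L.
Hypothesis e_right : right_id e op.
Hypothesis cip : forall x xr y, op x xr = e -> op (op x y) xr = y.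

(** A one-sided identity is already two-sided, since [e] is its own right
    inverse; so the quasigroup and loop cases have the same proof. *)
Lemma cip_left_id : left_id e op.
Proof. by move=> y; have := cip y (e_right e); rewrite e_right. Qed.

(** The identity at [xy] and [x^rho] reads [((xy) x^rho) (xy)^rho = x^rho], that
    is [y (xy)^rho = x^rho]; multiplying on the right by [y^rho] then gives
    [(xy)^rho = x^rho y^rho].  Bijectivity holds because the left inverse map
    is the two-sided inverse of [x |-> x^rho]. *)
Lemma cip_inverse_automorphism :
  exists2 J : L -> L, is_automorphism op J & forall x, op x (J x) = e.
Proof.
have [injl injr] := quasigroup_cancel quasi.
have [_ solr soll] := quasi.
have [J HJ] : exists J, forall x, op x (J x) = e.
  apply: (functional_choice (fun x xr => op x xr = e)) => x.
  by have [xr [? _]] := solr x e; exists xr.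
have [K HK] : exists K, forall x, op (K x) x = e.
  apply: (functional_choice (fun x xl => op xl x = e)) => x.
  by have [xl [? _]] := soll x e; exists xl.
exists J => //; split.
  exists K => x; first by apply: (injl (J x)); rewrite HJ HK.
  by apply: (injr (K x)); rewrite HJ HK.
move=> x y.
have yJ : op y (J (op x y)) = J x.
  by rewrite -(cip (J x) (HJ (op x y))) (cip y (HJ x)).
by rewrite -yJ (cip _ (HJ y)).
Qed.

Lemma cip_trivial_aut_involutive :
  (forall a : AUM op, sval a =1 id) -> forall x, op x x = e.
Proof.
have [J autJ HJ] := cip_inverse_automorphism.
by move=> triv x; rewrite -{2}(triv (exist _ J autJ) x) HJ.
Qed.

Lemma cip_involutive_flexible : (forall x, op x x = e) -> flexible op.
Proof.
have [injl _] := quasigroup_cancel quasi.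
move=> sq x y; rewrite (cip y (sq x)).
by apply: (injl x); rewrite (cip _ (sq x)).
Qed.

End Identity.

Definition aum_id : AUM op :=
  exist _ id (conj (Bijective (fun _ => erefl) (fun _ => erefl))
                   (fun _ _ => erefl)).

Lemma holomorph_cip_trivial_aut : cip_rho_outer (@hol_op L op) ->
  cip_rho_outer op /\ forall a : AUM op, sval a =1 id.
Proof.
case=> -[eps e] Eright Hcip.
have eps1 : sval eps =1 id.
  by move=> x; have /(congr1 (fun p => sval p.1 x)) := Eright (aum_id, e).
have e_right : right_id e op.
  move=> x; have /(congr1 snd) := Eright (aum_id, x).
  by rewrite /hol_op /= eps1.
have cip x xr y : op x xr = e -> op (op x y) xr = y.
  move=> xxr; have inv : hol_op (aum_id, x) (aum_id, xr) = (eps, e).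
    by rewrite /hol_op /= xxr; congr pair; apply: AUM_ext => z /=; rewrite eps1.
  by have /(congr1 snd) := Hcip _ _ (aum_id, y) inv.
split; first by exists e.
move=> a z; have [[b bK aK] am] := svalP a.
have bm : {morph b : u v / op u v}.
  by move=> u v; apply: (can_inj bK); rewrite am !aK.
have autb : is_automorphism op b by split=> //; exists (sval a).
have [_ solr _] := quasi; have [y [ey _]] := solr (b e) e.
pose q : holomorph op := (exist _ b autb, y).
have inv : hol_op (a, e) q = (eps, e).
  rewrite /hol_op /= ey; congr pair; apply: AUM_ext => u /=.
  by rewrite eps1 bK.
(* The product ((a, e) (1, z)) q has second component (e b . z b) y, which the
   property of the holomorph equates with z and that of L with z b. *)
have bz : b z = z.
  have /(congr1 snd) /= := Hcip _ _ (aum_id, z) inv.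
  by rewrite bm (cip _ _ _ ey).
by rewrite -[in LHS]bz aK.
Qed.

End CrossInverse.

Theorem corollary2p4 (L : Type) (op : L -> L -> L) :
  (is_quasigroup op -> is_CIPQ (@hol_op L op) ->
     [/\ flexible op, unipotent op & is_CIPQ op]) /\
  (is_loop op -> is_CIPL (@hol_op L op) ->
     [/\ flexible op, is_CIPL op & exponent2 op]).
Proof.
have core : is_quasigroup op -> is_quasigroup (@hol_op L op) ->
    cross_inverse (@hol_op L op) ->
    [/\ flexible op, cross_inverse op & exponent2 op].
  move=> Q QH /(cross_inverse_rho_outer QH).
  move=> /(holomorph_cip_trivial_aut Q) [cipL triv].
  have [e er cip] := cipL.
  have sq := cip_trivial_aut_involutive Q cip triv.
  split; first exact: (cip_involutive_flexible Q cip sq).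
    exact: Or41.
  by exists e; split=> //; apply: (cip_left_id er cip).
split=> [Q [QH CH]|[Q idL] [[QH _] CH]].
  have [fl CI [e [_ _ sq]]] := core Q QH CH.
  by split=> // x y; rewrite !sq.
by have [fl CI e2] := core Q QH CH.
Qed.
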